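(* Let $q$ be a prime power, $r,n,h$ positive integers with $h\le r-1$, and let $L_U$ be an $h$-scattered $\mathbb{F}_q$-linear set of rank $\frac{rn}{h+1}$ in $\Omega=\mathrm{PG}(r-1,q^n)$. For every $i\in\{0,\ldots,h\}$, the number of hyperplanes of $\Omega$ of weight $\frac{rn}{h+1}-n+i$ in $L_U$ is $$t_i=\frac{1}{q^n-1}{n \brack i}_q \sum_{j=0}^{h-i} (-1)^{j}{n-i \brack j}_q q^{\binom{j}{2}}\left(q^{\frac{rn(h-i-j+1)}{h+1}}-1\right).$$ In particular, $t_i>0$ for every $i\in\{0,\ldots,h\}$.
   Context: Let $V$ be an $r$-dimensional $\mathbb{F}_{q^n}$-vector space and $\Omega=\mathrm{PG}(V,\mathbb{F}_{q^n})=\mathrm{PG}(r-1,q^n)$. For a $k$-dimensional $\mathbb{F}_q$-subspace $U$ of $V$, the $\mathbb{F}_q$-linear set of rank $k$ defined by $U$ is $L_U=\{\langle\mathbf u\rangle_{\mathbb{F}_{q^n}}:\mathbf u\in U\setminus\{\mathbf 0\}\}$. The weight in $L_U$ of a subspace $\mathcal{S}=\mathrm{PG}(S,\mathbb{F}_{q^n})$ of $\Omega$ is $w_{L_U}(\mathcal{S})=\dim_{\mathbb{F}_q}(S\cap U)$. For a positive integer $h\le r-1$, $U$ (and $L_U$) is $h$-scattered if $\langle U\rangle_{\mathbb{F}_{q^n}}=V$ and $\dim_{\mathbb{F}_q}(U\cap H)\le h$ for every $h$-dimensional $\mathbb{F}_{q^n}$-subspace $H$ of $V$. The $q$-binomial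 coefficient ${s\brack t}_q$ is $0$ if $s<0$ or $t<0$ or $t>s$, is $1$ if $t=0$ and $s\ge 0$, and is $\prod_{i=1}^t\frac{q^{s-i+1}-1}{q^i-1}$ otherwise. *)

(* Defs.v *)
From HB Require Import structures.
From mathcomp Require Import all_boot all_order all_algebra all_field.

Set Implicit Arguments.
Unset Strict Implicit.
Unset Printing Implicit Defensive.

Import Order.TTheory GRing.Theory Num.Theory.
Local Open Scope ring_scope.

(* Restriction of scalars: a vector space V over an extension L of F, seen as *)
(* an F-space. This is fieldext's baseFieldType / baseVspace construction, for *)
(* a vector space instead of a field on top of L.                             *)
Section BaseVect.

Variables (F : fieldType) (L : fieldExtType F) (V : vectType L).

Definition base_vect : Type := V.
Local Notation V0 := base_vect.

HB.instance Definition _ := GRing.Zmodule.on V0.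

Definition base_scale (a : F) (u : V0) : V0 := (in_alg L a *: (u : V)).

Fact base_scaleA a b u : base_scale a (base_scale b u) = base_scale (a * b) u.
Proof. by rewrite /base_scale scalerA -rmorphM. Qed.

Fact base_scale1 u : base_scale 1 u = u.
Proof. by rewrite /base_scale rmorph1 scale1r. Qed.

Fact base_scaleDr a u v :
  base_scale a (u + v) = base_scale a u + base_scale a v.
Proof. exact: scalerDr. Qed.

Fact base_scaleDl v a b :
  base_scale (a + b) v = base_scale a v + base_scale b v.
Proof. by rewrite /base_scale rmorphD; exact: scalerDl. Qed.

HB.instance Definition _ := GRing.Zmodule_isLmodule.Build F V0
  base_scaleA base_scale1 base_scaleDr base_scaleDl.

Lemma base_vectZE (a : F) (u : V) : a *: (u : V0) = (a%:A : L) *: u.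
Proof. by []. Qed.

Let n := \dim {:L}.
Let bL : n.-tuple L := vbasis {:L}.
Let coordL (x : L) := (coord_vbasis (memvf x)).

Fact base_vectMixin : Lmodule_hasFinDim F V0.
Proof.
pose bV := vbasis {:V}; set m := \dim {:V} in bV.
pose v2r (x : V0) : 'rV[F]_(m * n) :=
  mxvec (\matrix_(i, j) coord bL j (coord bV i x)).
have v2r_lin: linear v2r.
  move=> a x y; rewrite -linearP; congr mxvec; apply/matrixP=> i j.
  by rewrite !mxE linearP /= mulr_algl linearP.
pose r2v (r : 'rV[F]_(m * n)) : V0 :=
  \sum_(i < m) (\sum_(j < n) vec_mx r i j *: bL`_j) *: (bV`_i : V).
have v2rK: cancel v2r r2v.
  move=> x; transitivity (\sum_(i < m) coord bV i x *: bV`_i); last first.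
    by rewrite -coord_vbasis ?memvf.
  apply: eq_bigr => i _; rewrite mxvecK; congr (_ *: _ : V).
  by rewrite (coordL (coord bV i x)); apply: eq_bigr => j _; rewrite mxE.
exists (m * n)%N, v2r => //; exists r2v => // r.
apply: (canLR vec_mxK); apply/matrixP=> i j; rewrite mxE.
by rewrite !coord_sum_free ?(basis_free (vbasisP _)).
Qed.

HB.instance Definition _ := base_vectMixin.

Let base_scaleZ a (x : L) (v : V) : a *: ((x *: v : V) : V0) = (a *: x) *: v.
Proof. by rewrite base_vectZE scalerA mulr_algl. Qed.

Let base_vspace_basis (S : {vspace V}) : seq V0 :=
  [seq tnth bL ij.2 *: tnth (vbasis S) ij.1 | ij : 'I_(\dim S) * 'I_n].
Definition base_vspace (S : {vspace V}) : {vspace V0} :=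
  <<base_vspace_basis S>>%VS.

Lemma mem_base_vspace (S : {vspace V}) : base_vspace S =i S.
Proof.
move=> y; apply/idP/idP=> [/coord_span->|/coord_vbasis->]; last first.
  apply: memv_suml => i _; rewrite (coordL (coord _ i (y : V))) scaler_suml -/n.
  apply: memv_suml => j _; rewrite -/bL -base_scaleZ memvZ ?memv_span //.
  by rewrite -!tnth_nth; apply/imageP; exists (i, j).
apply: memv_suml => k _; rewrite nth_image; case: (enum_val k) => i j /=.
by rewrite base_scaleZ memvZ ?vbasis_mem ?mem_tnth.
Qed.

Lemma dim_base_vspace (S : {vspace V}) :
  \dim (base_vspace S) = (\dim S * n)%N.
Proof.
pose bV0 := base_vspace_basis S; set m := \dim S in bV0 *.
suffices /size_basis->: basis_of (base_vspace S) bV0.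
  by rewrite card_prod !card_ord.
rewrite /basis_of eqxx.
apply/freeP=> s sb0 k; rewrite -(enum_valK k); case/enum_val: k => i j.
have free_baseP := freeP (basis_free (vbasisP _)).
move: j; apply: (free_baseP _ _ fullv); move: i; apply: (free_baseP _ _ S).
transitivity (\sum_i \sum_j s (enum_rank (i, j)) *: bV0`_(enum_rank (i, j))).
  apply: eq_bigr => i _; rewrite scaler_suml; apply: eq_bigr => j _.
  by rewrite -base_scaleZ nth_image enum_rankK -!tnth_nth.
rewrite pair_bigA (reindex _ (onW_bij _ (enum_val_bij _))); apply: etrans sb0.
by apply: eq_bigr => k _; rewrite -{5 6}[k](enum_valK k); case/enum_val: k.
Qed.

(* The L-span of an F-subspace is spanned by any F-basis of it; span_extP     *)
(* below states that it is the least L-subspace containing U.                 *)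
Definition span_ext (U : {vspace V0}) : {vspace V} :=
  <<(vbasis U : seq V)>>%VS.

Lemma span_extP (U : {vspace V0}) (S : {vspace V}) :
  reflect {subset U <= S} (span_ext U <= S)%VS.
Proof.
apply: (iffP span_subvP) => [sUS u Uu | sUS u bu]; last first.
  by apply: sUS; exact: vbasis_mem.
suff /subvP/(_ u Uu): (U <= base_vspace S)%VS by rewrite mem_base_vspace.
rewrite -(span_basis (vbasisP U)); apply/span_subvP => v bv.
by rewrite mem_base_vspace; apply: sUS.
Qed.

(* The weight of PG(S, L) in the F-linear set L_U. It depends on the subspace *)
(* U, not just on the set of points L_U, so linear sets are given by U.       *)
Definition weight (U : {vspace V0}) (S : {vspace V}) : nat :=
  \dim (base_vspace S :&: U).

Definition scattered (h : nat) (U : {vspace V0}) : Prop :=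
  span_ext U = fullv /\
  forall H : {vspace V}, \dim H = h -> (\dim (U :&: base_vspace H) <= h)%N.

Definition hyperplane (H : {vspace V}) : bool := (\dim H).+1 == \dim {:V}.

End BaseVect.

Definition exactly (T : eqType) (N : nat) (P : pred T) : Prop :=
  exists s : seq T, [/\ uniq s, s =i P & size s = N].

Definition qbinom (q : nat) (s t : int) : rat :=
  if [|| s < 0, t < 0 | t > s] then 0
  else if t == 0 then 1
  else \prod_(1 <= i < `|t|%N.+1)
         ((q%:R ^ (s - i%:Z + 1) - 1) / (q%:R ^+ i - 1)).

(* The divisions and subtractions of naturals in the exponents are exact when *)
(* h.+1 %| r * n, i <= h and j <= h - i.                                      *)
Definition hyperplane_count (q r n h i : nat) : rat :=
  (q%:R ^+ n - 1)^-1 * qbinom q n%:Z i%:Z *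
  \sum_(0 <= j < (h - i).+1)
     (-1) ^+ j * qbinom q (n%:Z - i%:Z) j%:Z * q%:R ^+ 'C(j, 2) *
     (q%:R ^+ (r * n * (h - i - j + 1) %/ h.+1) - 1).

(* Main.v *)
Require Import Defs.
From HB Require Import structures.
From mathcomp Require Import all_boot all_order all_algebra all_field.
From mathcomp Require Import mxabelem.
From mathcomp Require Import ring lra zify.
Set Implicit Arguments.
Unset Strict Implicit.
Unset Printing Implicit Defensive.
Import Order.TTheory GRing.Theory Num.Theory.
Local Open Scope ring_scope.

(** Write n for the degree of L over F, q for #|F|, r for the dimension of V,
    k for the dimension of U, so that (h + 1) k = r n. Hyperplanes of V are
    reached through the F-linear forms psi on V: the largest L-subspace H_psi
    inside ker psi is a hyperplane when psi <> 0, and each hyperplane is H_psi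
    for exactly q^n - 1 forms, namely the nonzero ones vanishing on it.

    The bilinear map (a, w) |-> psi (a w) from L x U to F has left kernel
    A_psi = {a | psi (a U) = 0} and right kernel U :&: H_psi, so equality of
    row and column rank gives dim (U :&: H_psi) = k - n + dim A_psi. Hence the
    weight of H_psi is k - n + i exactly when A_psi has dimension i, and the
    theorem is about the distribution of dim A_psi, called the defect below.

    The scattering condition enters through [scattered_tensor]: for s <= h + 1
    and a_1, ..., a_s in L independent over F, the sum of the subspaces a_t U is
    direct. A relation sum_t a_t w_t = 0 can be rewritten on an F-basis of the
    span of the w_t; this basis has at most h + 1 elements, so it is
    independent over L, and the relation is trivial. The forms killing all the
    a_t U thus make up the fraction q^(- s k) of all forms. Counting the pairs
    (psi, independent s-tuple of A_psi) in two ways gives [defect_moment]: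

      sum_psi (q^d - 1) (q^d - q) ... (q^d - q^(s-1))
        = (q^n - 1) ... (q^n - q^(s-1)) q^(k (h + 1 - s)),  d = dim A_psi.

    For s = h + 1 the right-hand side is the contribution of psi = 0 alone, so
    nonzero forms have defect at most h (here h < n, because U spans V and so
    k >= r). For s <= h the identities, divided by
    (q^s - 1) ... (q^s - q^(s-1)), prescribe the sums over psi <> 0 of the
    Gaussian binomials of d over s, a triangular system that the orthogonality
    of Gaussian binomials ([gauss_orthogonality]) inverts in closed form.

    Positivity is analytic: as n <= k, the terms of the alternating sum are
    positive and strictly decreasing ([gauss_weight_sum_gt0]). *)

(** * Gaussian binomials *)

Section GaussianBinomials.

Variables (R : realFieldType) (q : R).
Hypothesis q_gt1 : 1 < q.

(** Number of independent s-tuples in an n-dimensional space over a field with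
    q elements. *)
Definition qfalling n s := \prod_(t < s) (q ^+ n - q ^+ t).

(** In this quotient form (s-subspaces = independent s-tuples up to base change)
    the value is 0 for n < s, without a case distinction. *)
Definition gauss n s := qfalling n s / qfalling s s.

Let q_gt0 : 0 < q. Proof. exact: lt_trans ltr01 q_gt1. Qed.

Let q_neq0 : q != 0. Proof. by rewrite gt_eqF. Qed.

Let qX_neq0 t : q ^+ t != 0. Proof. exact: expf_neq0. Qed.

Let qXB_neq0 t : q ^+ t.+1 - 1 != 0.
Proof. by rewrite subr_eq0 gt_eqF // exprn_egt1. Qed.

Lemma qfalling0 n : qfalling n 0 = 1.
Proof. exact: big_ord0. Qed.

Lemma qfallingS n s : qfalling n s.+1 = qfalling n s * (q ^+ n - q ^+ s).
Proof. exact: big_ord_recr. Qed.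

Lemma qfalling_small n s : (n < s)%N -> qfalling n s = 0.
Proof.
by move=> ns; rewrite /qfalling (bigD1 (Ordinal ns)) //= subrr mul0r.
Qed.

Lemma qfalling_gt0 n s : (s <= n)%N -> 0 < qfalling n s.
Proof.
move=> sn; apply: prodr_gt0 => t _.
by rewrite subr_gt0 ltr_eXn2l // (leq_trans _ sn).
Qed.

Lemma qfalling_neq0 n s : (s <= n)%N -> qfalling n s != 0.
Proof. by move=> sn; rewrite gt_eqF ?qfalling_gt0. Qed.

Lemma qfallingSS n s :
  qfalling n.+1 s.+1 = (q ^+ n.+1 - 1) * q ^+ s * qfalling n s.
Proof.
rewrite /qfalling big_ord_recl expr0 -mulrA; congr (_ * _).
have -> : q ^+ s = \prod_(t < s) q by rewrite prodr_const card_ord.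
rewrite -big_split /=.
by apply: eq_bigr => t _; rewrite mulrBr -!exprS.
Qed.

Lemma qfallingD i n s :
  qfalling (i + n) (i + s) = qfalling (i + n) i * q ^+ (i * s) * qfalling n s.
Proof.
rewrite /qfalling big_split_ord /= -mulrA; congr (_ * _).
have -> : q ^+ (i * s) = \prod_(t < s) q ^+ i.
  by rewrite prodr_const card_ord exprM.
rewrite -big_split /=.
by apply: eq_bigr => t _; rewrite mulrBr -!exprD.
Qed.

Lemma gauss0 n : gauss n 0 = 1.
Proof. by rewrite /gauss !qfalling0 divr1. Qed.

Lemma gauss_small n s : (n < s)%N -> gauss n s = 0.
Proof. by move=> ns; rewrite /gauss qfalling_small // mul0r. Qed.

Lemma gauss_gt0 n s : (s <= n)%N -> 0 < gauss n s.
Proof. by move=> sn; rewrite divr_gt0 ?qfalling_gt0. Qed.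

Lemma gaussS n s :
  gauss n s.+1 = gauss n s * (q ^+ n - q ^+ s) / (q ^+ s * (q ^+ s.+1 - 1)).
Proof.
rewrite /gauss qfallingS qfallingSS; field.
by rewrite qfalling_neq0 // qXB_neq0 qX_neq0.
Qed.

Lemma gaussSS n s :
  gauss n.+1 s.+1 = gauss n s * (q ^+ n.+1 - 1) / (q ^+ s.+1 - 1).
Proof.
rewrite /gauss !qfallingSS; field.
by rewrite qfalling_neq0 // qXB_neq0 qX_neq0.
Qed.

Lemma gauss_pascal n s :
  gauss n.+1 s.+1 = gauss n s + q ^+ s.+1 * gauss n s.+1.
Proof.
rewrite gaussSS gaussS !exprS; field.
by rewrite -exprS qXB_neq0 qX_neq0.
Qed.

(** Both sides count flags of an i-subspace inside an (i + j)-subspace of a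
    space of dimension i + m. *)
Lemma gauss_trinomial i m j :
  gauss (i + m) (i + j) * gauss (i + j) i = gauss (i + m) i * gauss m j.
Proof.
rewrite /gauss !(qfallingD i).
by field; rewrite qX_neq0 !qfalling_neq0 // leq_addr.
Qed.

(** Pascal's rule makes the terms telescope. The partial sum vanishes as soon as
    m < N, which is the orthogonality needed below. *)
Lemma gauss_alternating m N :
  \sum_(j < N.+1) (-1) ^+ j * q ^+ 'C(j, 2) * gauss m.+1 j
    = (-1) ^+ N * q ^+ 'C(N.+1, 2) * gauss m N.
Proof.
elim: N => [|N IHN]; first by rewrite big_ord1 !gauss0.
rewrite big_ord_recr /= {}IHN gauss_pascal.
rewrite (binS N.+1 1) bin1 exprD exprS; ring.
Qed.

(** The inversion formula for a triangular system whose coefficients are the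
    gauss d s: the weights on the left extract the indicator of d = i. *)
Lemma gauss_orthogonality d i h : (d <= h)%N ->
  \sum_(j < (h - i).+1)
     (-1) ^+ j * q ^+ 'C(j, 2) * gauss (i + j) i * gauss d (i + j)
  = (d == i)%:R.
Proof.
move=> dh; have [di|id|->] := ltngtP d i.
- by rewrite big1 // => j _; rewrite (gauss_small (n := d)) ?mulr0 // ltn_addr.
- have [m mE] : exists m, d = (i + m.+1)%N by exists (d - i).-1; lia.
  have mh : (m < h - i)%N by lia.
  transitivity (gauss d i * \sum_(j < (h - i).+1)
      (-1) ^+ j * q ^+ 'C(j, 2) * gauss m.+1 j); last first.
    by rewrite gauss_alternating (gauss_small mh) !mulr0.
  rewrite mulr_sumr; apply: eq_bigr => j _.
  by rewrite mE -mulrA [gauss (i + j) i * _]mulrC gauss_trinomial mulrCA.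
- rewrite big_ord_recl big1 ?addr0 => [|j _].
    by rewrite addn0 /gauss !divff ?qfalling_neq0 // !mulr1.
  by rewrite (gauss_small (n := i)) ?mulr0 // lift0; lia.
Qed.

Lemma alternating_sum_gt0 (a : nat -> R) l :
    (forall j, (j <= l)%N -> 0 < a j) ->
    (forall j, (j < l)%N -> a j.+1 < a j) ->
  0 < \sum_(j < l.+1) (-1) ^+ j * a j.
Proof.
move=> a_gt0 a_decr.
(* The upper bound is what makes the induction go through. *)
suff /andP[] : 0 < \sum_(j < l.+1) (-1) ^+ j * a j <= a 0 by [].
elim: l a a_gt0 a_decr => [|l IHl] a a_gt0 a_decr.
  by rewrite big_ord1 mul1r lexx a_gt0.
have /andP[] := IHl (fun j => a j.+1) (fun j => a_gt0 j.+1)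
  (fun j => a_decr j.+1).
have -> : \sum_(j < l.+2) (-1) ^+ j * a j
    = a 0 - \sum_(j < l.+1) (-1) ^+ j * a j.+1.
  rewrite big_ord_recl mul1r -sumrN; congr (_ + _).
  by apply: eq_bigr => j _; rewrite lift0 exprS mulN1r mulNr.
by move=> S_gt0 S_le; have := a_decr 0 isT; lra.
Qed.

(** Consecutive terms have a ratio below
    (q^m - q^j) / ((q^(j+1) - 1) q^k) < 1, hence the sum is alternating with
    decreasing terms. *)
Lemma gauss_weight_sum_gt0 m k l : 2 <= q -> (l < m)%N -> (m <= k)%N ->
  0 < \sum_(j < l.+1)
        (-1) ^+ j * gauss m j * q ^+ 'C(j, 2) * ((q ^+ k) ^+ (l - j + 1) - 1).
Proof.
move=> q_ge2 lm mk.
set Q := q ^+ k.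
have k_gt0 : (0 < k)%N by lia.
have Q_gt1 : 1 < Q by rewrite exprn_egt1 // -lt0n.
have w_gt0 j : (j <= m)%N -> 0 < gauss m j * q ^+ 'C(j, 2).
  by move=> jm; apply: mulr_gt0; [exact: gauss_gt0 | exact: exprn_gt0].
pose a j := gauss m j * q ^+ 'C(j, 2) * (Q ^+ (l - j + 1) - 1).
under eq_bigr => j _ do rewrite -2!mulrA [gauss m j * _]mulrA -/(a j).
apply: alternating_sum_gt0 => j jl; rewrite /a.
  by rewrite mulr_gt0 ?w_gt0 ?subr_gt0 ?exprn_egt1 ?addn1 //; lia.
rewrite binS bin1 exprD gaussS.
have -> : (l - j + 1 = (l - j.+1 + 1).+1)%N by lia.
set P := Q ^+ (l - j.+1 + 1); rewrite [Q ^+ _.+1]exprS -/P.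
have P_gt1 : 1 < P by rewrite exprn_egt1 // addn1.
have g_gt0 : 0 < gauss m j * q ^+ 'C(j, 2).
  have jm : (j <= m)%N by lia.
  by rewrite mulr_gt0 ?gauss_gt0 ?exprn_gt0.
have -> : gauss m j * (q ^+ m - q ^+ j) / (q ^+ j * (q ^+ j.+1 - 1)) *
    (q ^+ 'C(j, 2) * q ^+ j) * (P - 1) =
    gauss m j * q ^+ 'C(j, 2) * ((q ^+ m - q ^+ j) * (P - 1) / (q ^+ j.+1 - 1)).
  by field; rewrite qXB_neq0 qX_neq0.
rewrite ltr_pM2l //.
have d_ge1 : 1 <= q ^+ j.+1 - 1.
  have : q <= q ^+ j.+1 by rewrite ler_eXnr // ltW.
  by lra.
rewrite ltr_pdivrMr; last by lra.
have qj_gt0 : 0 < q ^+ j by rewrite exprn_gt0.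
have qmQ : q ^+ m <= Q by rewrite ler_eXn2l.
apply: (@lt_le_trans _ _ (Q * P - 1)).
  have : (q ^+ m - q ^+ j) * (P - 1) <= Q * (P - 1).
    by rewrite ler_pM2r ?subr_gt0 //; lra.
  by rewrite mulrBr mulr1; lra.
by rewrite ler_peMr // subr_ge0 mulr_ege1 ?ltW.
Qed.

End GaussianBinomials.

Lemma qbinomE q n t : (1 < q)%N -> qbinom q n%:Z t%:Z = gauss q%:R n t.
Proof.
move=> q_gt1; have Q_gt1 : 1 < q%:R :> rat by rewrite ltr1n.
rewrite /qbinom ltz_nat /=; case: ltnP => [nt|tn]; first by rewrite gauss_small.
case: t tn => [_|t tn]; first by rewrite gauss0.
rewrite /= big_add1 /= big_mkord.
elim: t tn => [|t IHt] tn.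
  by rewrite big_ord1 gaussS // gauss0 !expr0 !mul1r subrK.
rewrite big_ord_recr /= IHt 1?ltnW // [RHS]gaussS //.
have -> : n%:Z - t.+2%:Z + 1 = (n - t.+1)%N%:Z by lia.
rewrite -exprnP.
have -> : q%:R ^+ n = q%:R ^+ t.+1 * q%:R ^+ (n - t.+1) :> rat.
  by rewrite -exprD subnKC // ltnW.
have ? : q%:R ^+ t.+1 != 0 :> rat.
  by rewrite gt_eqF // exprn_gt0 // (lt_trans ltr01).
have ? : q%:R ^+ t.+2 - 1 != 0 :> rat.
  by rewrite subr_eq0 gt_eqF // exprn_egt1.
by field; apply/andP.
Qed.

(** * Counting over a finite field *)

Section FiniteFieldCounts.

Variable F : finFieldType.
Local Notation q := (#|F|%:R : rat).

Lemma row_free_col_mx s n (x : 'rV[F]_n) (S : 'M[F]_(s, n)) :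
  row_free (col_mx x S) = row_free S && ~~ (x <= S)%MS.
Proof.
rewrite /row_free -addsmxE; have [xS|x'S] := boolP (x <= S)%MS.
  by rewrite (addsmx_idPr xS) andbF; apply: ltn_eqF; rewrite ltnS rank_leq_row.
have x_neq0 : x != 0 by apply: contraNneq x'S => ->; rewrite sub0mx.
have cap0 : \rank (x :&: S)%MS = 0%N.
  suff : (\rank (x :&: S)%MS < \rank x)%N.
    by rewrite rank_rV x_neq0 ltnS leqn0 => /eqP.
  rewrite ltn_neqAle (mxrank_leqif_sup (capmxSl x S)).1 andbT.
  by rewrite (mxrank_leqif_sup (capmxSl x S)).2 sub_capmx submx_refl.
have := mxrank_sum_cap x S; rewrite cap0 addn0 rank_rV x_neq0 => ->.
by rewrite add1n eqSS andbT.
Qed.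

(** A row can be added on top of S exactly when it lies in the row space of K
    but not in that of S, which leaves q^(rank K) - q^s choices. *)
Lemma card_row_free_sub m n s (K : 'M[F]_(m, n)) :
  #|[set S : 'M[F]_(s, n) | row_free S & (S <= K)%MS]|%:R
    = qfalling q (\rank K) s.
Proof.
elim: s => [|s IHs].
  rewrite qfalling0 (_ : [set _ | _ & _] = [set: 'M[F]_(0, n)]); last first.
    apply/setP=> S; rewrite !inE flatmx0 sub0mx andbT.
    by rewrite /row_free mxrank0.
  by rewrite cardsT card_mx mul0n expn0.
rewrite qfallingS -{}IHs -sum1dep_card.
rewrite (reindex (fun p : 'M[F]_(s, n) * 'rV[F]_n => col_mx p.2 p.1)); last
  first.
  exists (fun S : 'M_(1 + s, n) => (dsubmx S, usubmx S)) => [[S x]|S] _ /=.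
    by rewrite col_mxKd col_mxKu.
  by rewrite vsubmxK.
pose A := [set S : 'M[F]_(s, n) | row_free S & (S <= K)%MS].
transitivity ((\sum_(S in A) \sum_(x in rowg K :\: rowg S) 1)%N%:R : rat).
  rewrite pair_big_dep /=; congr _%:R; apply: eq_bigl => -[S x].
  rewrite !inE /= row_free_col_mx (col_mx_sub x S K).
  by case: (row_free S); case: (x <= S)%MS; case: (x <= K)%MS;
     case: (S <= K)%MS.
rewrite natr_sum (eq_bigr (fun=> q ^+ \rank K - q ^+ s)).
  by rewrite sumr_const mulr_natl.
move=> S; rewrite inE => /andP[Sfree SK]; rewrite sum1_card cardsD.
have sSK : rowg S \subset rowg K.
  by apply/subsetP=> x; rewrite !mem_rowg => /submx_trans; apply.
rewrite (setIidPr sSK) natrB ?subset_leq_card // !card_rowg !natrX.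
by rewrite (eqP Sfree).
Qed.

Lemma card_mulmx_eq0 m p (f : 'M[F]_(m, p)) :
  #|[set x : 'rV[F]_m | x *m f == 0]| = (#|F| ^ (m - \rank f))%N.
Proof.
rewrite -mxrank_ker -card_rowg; apply: eq_card => x.
by rewrite mem_rowg inE; apply/eqP/sub_kermxP.
Qed.

End FiniteFieldCounts.

(** * Linear forms on a space over a finite field *)

Section Forms.

Import passmx.

Variables (F : finFieldType) (vT : vectType F).
Local Notation N := (\dim {:vT}).
Local Notation row_of := (rVof (vbasis {:vT})).

Let row_of_inj : injective row_of.
Proof. exact: can_inj (rVofK (vbasisP _)). Qed.

(** Linear forms are encoded by their coordinate rows, so that they range over a
    finite type. *)
Definition lform (psi : 'rV[F]_N) (v : vT) : F^o := (psi *m (row_of v)^T) 0 0.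

Fact lform_is_linear psi : linear (lform psi).
Proof.
move=> a v w; rewrite /lform linearP linearD linearZ mulmxDr -scalemxAr.
by rewrite 2!mxE.
Qed.

HB.instance Definition _ psi :=
  GRing.isLinear.Build F vT F^o _ (lform psi) (lform_is_linear psi).

Lemma lform0l v : lform 0 v = 0.
Proof. by rewrite /lform mul0mx mxE. Qed.

Lemma lform_eq0 psi : (forall v, lform psi v = 0) -> psi = 0.
Proof.
move=> psi0; apply/rowP=> j; rewrite [RHS]mxE.
rewrite -(psi0 (vecof (vbasis {:vT}) (delta_mx 0 j))).
by rewrite /lform vecofK ?vbasisP // trmx_delta -colE mxE.
Qed.

(** A free family imposes independent conditions on a form; a family indexed by
    any finite type is allowed because products of index sets are needed. *)
Lemma card_lform_eq0 (I : finType) (e : I -> vT) :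
    (forall c : I -> F, \sum_i c i *: e i = 0 -> forall i, c i = 0) ->
  #|[set psi | [forall i, lform psi (e i) == 0]]| = (#|F| ^ (N - #|I|))%N.
Proof.
move=> e_free; pose M := \matrix_(i < #|I|) row_of (e (enum_val i)).
have /eqP <- : row_free M.
  apply: inj_row_free => c cM0.
  have c0 : \sum_i c 0 (enum_rank i) *: e i = 0.
    apply: row_of_inj; rewrite [RHS]linear0 -cM0 mulmx_sum_row linear_sum /=.
    rewrite (reindex_onto enum_rank enum_val) => [|i _]; last exact: enum_valK.
    under [RHS]eq_bigl do rewrite enum_rankK eqxx.
    by apply: eq_bigr => i _; rewrite linearZ rowK enum_rankK.
  by apply/rowP=> i; rewrite mxE -(enum_valK i) (e_free _ c0).
rewrite -mxrank_tr -card_mulmx_eq0; apply: eq_card => psi; rewrite !inE.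
apply/forallP/eqP=> [psi0|psiM i].
  apply/rowP=> i; rewrite [RHS]mxE -(eqP (psi0 (enum_val i))) /lform !mxE.
  by apply: eq_bigr => j _; rewrite !mxE.
have := congr1 (fun v : 'rV_ _ => v 0 (enum_rank i)) psiM.
rewrite mxE [RHS]mxE => <-; apply/eqP; rewrite /lform mxE.
by apply: eq_bigr => j _; rewrite !mxE enum_rankK.
Qed.

End Forms.

(** * Spans of the rows of a matrix *)

Section RowSpans.

Variables (F : fieldType) (n : nat).

Let rows m (M : 'M[F]_(m, n)) := [seq row i M | i : 'I_m].

Let size_rows m (M : 'M_(m, n)) : size (rows M) == m.
Proof. by rewrite size_map size_enum_ord. Qed.

Let nth_rows m (M : 'M_(m, n)) (i : 'I_m) : (rows M)`_i = row i M.
Proof. by rewrite (nth_map i) ?nth_ord_enum // size_enum_ord. Qed.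

Lemma mem_span_rows m (M : 'M[F]_(m, n)) v :
  (v \in <<rows M>>%VS) = (v <= M)%MS.
Proof.
apply/idP/submxP=> [/(coord_span (X := Tuple (size_rows M)))->|[c ->]].
  exists (\row_i coord (Tuple (size_rows M)) i v).
  by rewrite mulmx_sum_row; apply: eq_bigr => i _; rewrite mxE nth_rows.
rewrite mulmx_sum_row; apply: memv_suml => i _; apply/memvZ/memv_span.
by apply: map_f; rewrite mem_enum.
Qed.

Lemma dim_span_rows m (M : 'M[F]_(m, n)) :
  \dim <<rows M>> = \rank M.
Proof.
have -> : <<rows M>>%VS = <<rows (row_base M)>>%VS.
  by apply/vspaceP=> v; rewrite !mem_span_rows eq_row_base.
suff /eqP -> : free (Tuple (size_rows (row_base M))) by rewrite size_tuple.
apply/freeP=> c c0 i.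
have : \row_i c i *m row_base M = 0.
  rewrite mulmx_sum_row -[RHS]c0.
  by apply: eq_bigr => j _; rewrite mxE nth_rows.
move/(congr1 (mulmxr (pinvmx (row_base M)))).
rewrite /= -mulmxA mulmxVp ?row_base_free // mulmx1 mul0mx.
by move/rowP/(_ i); rewrite !mxE.
Qed.

End RowSpans.

(** * Free families in scattered subspaces *)

Section Extensions.

Variables (K : fieldType) (vT : vectType K).
Implicit Types (X Y : seq vT) (U S : {vspace vT}).

Lemma free_extend U X d :
    free X -> {subset X <= U} -> (size X <= d)%N -> (d <= \dim U)%N ->
  exists Y, [/\ free (X ++ Y), {subset X ++ Y <= U} & size (X ++ Y) = d].
Proof.
move=> freeX XU Xd dU; pose Z := vbasis (U :\: <<X>>).
have sXU : (<<X>> <= U)%VS by apply/span_subvP.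
have freeXZ : free (X ++ Z).
  rewrite cat_free freeX (basis_free (vbasisP _)) (span_basis (vbasisP _)) /=.
  by apply/directv_addP; rewrite capvC capv_diff.
have sizeXZ : size (X ++ Z) = \dim U.
  rewrite size_cat size_tuple -(eqP freeX) -(dimv_cap_compl U <<X>>).
  by rewrite (capv_idPr sXU).
have XZU : {subset X ++ Z <= U}.
  move=> v; rewrite mem_cat => /orP[/XU //|/vbasis_mem].
  exact: (subvP (diffvSl _ _)).
exists (take (d - size X) Z).
have -> : X ++ take (d - size X) Z = take d (X ++ Z).
  by rewrite take_cat ltnNge Xd.
split; last by rewrite size_takel // sizeXZ.
  by apply: (@catl_free _ _ (drop d (X ++ Z))); rewrite cat_take_drop.
by move=> v /mem_take/XZU.
Qed.

Lemma vspace_extend S d :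
    (\dim S <= d)%N -> (d <= \dim {:vT})%N ->
  exists2 H : {vspace vT}, (S <= H)%VS & \dim H = d.
Proof.
move=> Sd dV; have freeS := basis_free (vbasisP S).
have [] := @free_extend fullv (vbasis S) d; rewrite ?size_tuple //.
  by move=> v _; exact: memvf.
move=> Y [freeSY _ sizeSY]; exists <<vbasis S ++ Y>>%VS.
  by rewrite span_cat (span_basis (vbasisP S)) addvSl.
by rewrite (eqP freeSY).
Qed.

End Extensions.

Section Scattered.

Variables (F : fieldType) (L : fieldExtType F) (V : vectType L).
Variables (U : {vspace base_vect V}) (h : nat).
Hypothesis scatU : scattered h U.

(** An F-basis of U generates V over L. *)
Lemma scattered_dim_ge : (\dim {:V} <= \dim U)%N.
Proof.
have [spanU _] := scatU.
rewrite -spanU /span_ext (leq_trans (dim_span _)) // size_tuple //.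
Qed.

Hypothesis h_lt : (h < \dim {:V})%N.

(** The scattering condition only bounds traces of subspaces of dimension
    exactly h. So X is first completed to h + 1 independent vectors of U: if
    these were L-dependent, their L-span would fit into an h-dimensional
    subspace meeting U in dimension at least h + 1. *)
Lemma scattered_free (X : seq V) :
    free (X : seq (base_vect V)) -> {subset X <= U} -> (size X <= h.+1)%N ->
  free X.
Proof.
move=> freeX XU Xh.
have [Y [freeXY XYU sizeXY]] :=
  free_extend freeX XU Xh (leq_trans h_lt scattered_dim_ge).
suff : free (X ++ Y : seq V) by apply: catl_free.
rewrite /free eqn_leq dim_span leqNgt; apply/negP=> spanXY.
rewrite sizeXY ltnS in spanXY.
have [H XYH dimH] := vspace_extend spanXY (ltnW h_lt).
have [_ /(_ H dimH)] := scatU; apply/negP; rewrite -ltnNge -sizeXY.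
rewrite -(eqP freeXY); apply/dimvS/span_subvP => v XYv.
rewrite memv_cap XYU // mem_base_vspace; apply: (subvP XYH).
exact: (@memv_span _ V).
Qed.

(** Expanding the w t on an F-basis X of their span turns the relation into an
    L-relation on X, which is L-free because it has at most s <= h + 1
    elements; its coefficients are F-combinations of the a t. *)
Lemma scattered_tensor s (a : 'I_s -> L) (w : 'I_s -> V) :
    (s <= h.+1)%N ->
    (forall c : 'I_s -> F, \sum_t c t *: a t = 0 -> forall t, c t = 0) ->
    (forall t, w t \in U) ->
  \sum_t a t *: w t = 0 -> forall t, w t = 0.
Proof.
move=> sh a_free wU aw0.
pose w0 : 'I_s -> base_vect V := w.
pose W := <<[seq w0 t | t : 'I_s]>>%VS; pose X := vbasis W.
have wW t : w0 t \in W by apply/memv_span/map_f; rewrite mem_enum.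
have sizeX : (\dim W <= h.+1)%N.
  by rewrite (leq_trans (dim_span _)) // size_map size_enum_ord.
have WU : (W <= U)%VS.
  by apply/span_subvP => _ /mapP[t _ ->]; exact: wU.
have freeX : free (X : seq (base_vect V)) := basis_free (vbasisP W).
have freeXL : free (X : seq V).
  apply: scattered_free => //; last by rewrite size_tuple.
  by move=> x Xx; apply: (subvP WU); apply: vbasis_mem; exact: Xx.
have wE t : w t = \sum_j (coord X j (w0 t))%:A *: (X`_j : V).
  exact: (coord_vbasis (wW t)).
pose XL : (\dim W).-tuple V := X.
have c0 j : \sum_t coord X j (w0 t) *: a t = 0.
  pose c i := \sum_t coord X i (w0 t) *: a t.
  move: j; apply: (@freeP _ V _ XL freeXL c).
  rewrite -[RHS]aw0.
  under [RHS]eq_bigr do rewrite wE scaler_sumr.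
  rewrite exchange_big /=; apply: eq_bigr => j _.
  rewrite scaler_suml; apply: eq_bigr => t _.
  by rewrite scalerA -[_ *: a t]mulr_algl mulrC.
move=> t; rewrite wE big1 // => j _.
by rewrite (a_free _ (c0 j)) scale0r scale0r.
Qed.

End Scattered.

(** * Forms and hyperplanes *)

Section FormsAndHyperplanes.

Import passmx.

Variables (F : finFieldType) (L : fieldExtType F) (V : vectType L).
Variables (U : {vspace base_vect V}) (h : nat).
Local Notation n := (\dim {:L}).
Local Notation k := (\dim U).
Local Notation r := (\dim {:V}).
Local Notation N := (\dim {: base_vect V}).
Local Notation e := (vbasis {:L}).
Local Notation u := (vbasis U).
Implicit Types (psi : 'rV[F]_N) (a : L) (v : base_vect V) (H : {vspace V}).

(** Multiplication by elements of L, typed as an operation on the F-space V so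
    that F-linear forms apply to its values. *)
Definition ext_scale a v : base_vect V := a *: (v : V).
Local Notation "a *:: v" := (ext_scale a v) (at level 40, left associativity).

Lemma ext_scale_is_linear a : linear (ext_scale a).
Proof.
move=> c v w; rewrite /ext_scale [LHS]scalerDr; congr (_ + _).
by rewrite !base_vectZE !scalerA mulrC.
Qed.

HB.instance Definition _ a :=
  GRing.isLinear.Build F (base_vect V) (base_vect V) _ (ext_scale a)
    (ext_scale_is_linear a).

Lemma ext_scale_suml (I : finType) (c : I -> F) (a : I -> L) v :
  (\sum_i c i *: a i) *:: v = \sum_i c i *: (a i *:: v).
Proof.
rewrite /ext_scale [LHS]scaler_suml; apply: eq_bigr => i _.
by rewrite base_vectZE scalerA mulr_algl.
Qed.

(** The matrix of (a, w) |-> psi (a w) on L x U: its left kernel is A_psi and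
    its right kernel is the trace on U of the hyperplane of psi. *)
Definition gram psi : 'M[F]_(n, k) :=
  \matrix_(i, j) lform psi (e`_i *:: u`_j).

Lemma mul_gramE psi s (S : 'M[F]_(s, n)) t j :
  (S *m gram psi) t j = lform psi (vecof e (row t S) *:: u`_j).
Proof.
rewrite mxE /vecof ext_scale_suml linear_sum; apply: eq_bigr => i _.
by rewrite !mxE linearZ.
Qed.

Lemma dim_base_vect : N = (r * n)%N.
Proof.
rewrite -dim_base_vspace; congr (\dim _).
apply/vspaceP=> v; apply/idP/idP=> _; last exact: memvf.
by rewrite mem_base_vspace; exact: (@memvf _ V v).
Qed.

(** The rows of S are independent elements a_t of L, and the condition says that
    psi kills every a_t U. By [scattered_tensor] the s k products a_t u_j are
    F-free, so these conditions are independent. *)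
Lemma card_mul_gram_eq0 s (S : 'M[F]_(s, n)) :
    scattered h U -> (h < r)%N -> row_free S -> (s <= h.+1)%N ->
  #|[set psi | S *m gram psi == 0]| = (#|F| ^ (N - s * k))%N.
Proof.
move=> scatU hr freeS sh; pose a t := vecof e (row t S).
have a_free (c : 'I_s -> F) : \sum_t c t *: a t = 0 -> forall t, c t = 0.
  have -> : \sum_t c t *: a t = vecof e (\row_t c t *m S).
    rewrite mulmx_sum_row linear_sum; apply: eq_bigr => t _.
    by rewrite linearZ mxE.
  move/eqP; rewrite vecof_eq0 ?vbasisP // => /eqP cS0 t.
  have /rowP/(_ t) : \row_t c t = 0.
    by apply: (row_free_inj freeS); rewrite mul0mx.
  by rewrite !mxE.
rewrite (_ : s * k = #|{: 'I_s * 'I_k}|)%N; last first.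
  by rewrite card_prod !card_ord.
rewrite -(card_lform_eq0 (e := fun tj : 'I_s * 'I_k => a tj.1 *:: u`_tj.2)).
  apply: eq_card => psi; rewrite !inE.
  apply/eqP/forallP=> [S0 [t j]|S0]; first by rewrite -mul_gramE S0 mxE.
  by apply/matrixP=> t j; rewrite mul_gramE (eqP (S0 (t, j))) mxE.
move=> c c0 [t j].
have w0 : \sum_t a t *:: (\sum_j c (t, j) *: u`_j) = 0.
  transitivity (\sum_t \sum_j c (t, j) *: (a t *:: u`_j)); last first.
    by rewrite pair_bigA -[RHS]c0; apply: eq_bigr => -[].
  apply: eq_bigr => t' _; rewrite linear_sum; apply: eq_bigr => j' _.
  by rewrite linearZ.
have wU t' : (\sum_j c (t', j) *: u`_j : base_vect V) \in U.
  apply: memv_suml => j' _; apply/memvZ/vbasis_mem/mem_nth.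
  by rewrite size_tuple.
have ut0 := scattered_tensor scatU hr sh a_free wU w0 t.
exact: (freeP (basis_free (vbasisP U)) (fun j => c (t, j)) ut0 j).
Qed.

(** The restriction of psi to the line L v, in coordinates; its kernel as a
    function of v is the set of v with psi (L v) = 0. *)
Definition orbit_form psi v : 'rV[F]_n := \row_i lform psi (e`_i *:: v).

Lemma orbit_form_is_linear psi : linear (orbit_form psi).
Proof. by move=> c v w; apply/rowP=> i; rewrite !mxE !linearP. Qed.

HB.instance Definition _ psi :=
  GRing.isLinear.Build F (base_vect V) 'rV[F]_n _ (orbit_form psi)
    (orbit_form_is_linear psi).

Definition form_core psi : {vspace base_vect V} :=
  lker (linfun (orbit_form psi)).

Lemma form_coreP psi v :
  reflect (forall a, lform psi (a *:: v) = 0) (v \in form_core psi).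
Proof.
rewrite memv_ker lfunE /=; apply: (iffP eqP) => [v0 a | v0].
  rewrite (coord_vbasis (memvf a)) ext_scale_suml linear_sum big1 // => i _.
  have /rowP/(_ i) := v0; rewrite !mxE => v0i.
  by rewrite linearZ /= v0i scaler0.
by apply/rowP=> i; rewrite !mxE v0.
Qed.

(** The core of ker psi is already stable under L; taking its L-span only
    retypes it as an L-subspace. *)
Definition form_hyperplane psi : {vspace V} := span_ext (form_core psi).

Lemma base_form_hyperplane psi :
  base_vspace (form_hyperplane psi) = form_core psi.
Proof.
have core_sub : {subset form_core psi <= form_hyperplane psi}.
  exact: (span_extP _ _ (subvv (span_ext (form_core psi)))).
apply/vspaceP=> v; rewrite mem_base_vspace; apply/idP/idP; last exact: core_sub.
pose X : (\dim (form_core psi)).-tuple V := vbasis (form_core psi).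
move/(@coord_span _ V _ X) => ->.
apply: (@memv_suml _ (base_vect V)) => i _; apply/form_coreP => a.
have /form_coreP := vbasis_mem (mem_tnth i (vbasis (form_core psi))).
move/(_ (a * coord X i (v : V))); rewrite (tnth_nth 0) => <-.
by rewrite /ext_scale scalerA.
Qed.

Lemma dim_cap_form_core psi :
  (\dim (form_core psi :&: U) + \rank (gram psi))%N = k.
Proof.
rewrite -[RHS](limg_ker_dim (linfun (orbit_form psi)) U) capvC.
congr (_ + _)%N; rewrite -mxrank_tr -dim_span_rows; congr (\dim _).
rewrite -[in RHS](span_basis (vbasisP U)) limg_span; congr span.
rewrite -[in RHS](map_tnth_enum u) -map_comp; apply: eq_map => j /=.
by rewrite lfunE; apply/rowP=> i; rewrite !mxE (tnth_nth 0).
Qed.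

Lemma weight_form_hyperplane psi :
  (weight U (form_hyperplane psi) + \rank (gram psi))%N = k.
Proof. by rewrite /weight base_form_hyperplane dim_cap_form_core. Qed.

Lemma lform_core0 psi v : v \in form_core psi -> lform psi v = 0.
Proof. by move/form_coreP/(_ 1); rewrite /ext_scale scale1r. Qed.

(** The core is the kernel of a map to F^n, so it has F-codimension at most n,
    that is L-codimension at most 1; it is proper because psi <> 0. *)
Lemma hyperplane_form psi : psi != 0 -> hyperplane (form_hyperplane psi).
Proof.
move=> psi_neq0; have n_gt0 : (0 < n)%N by apply: adim_gt0.
rewrite /hyperplane eqn_leq; apply/andP; split.
  rewrite ltn_neqAle dimvS ?subvf // andbT (dimv_leqif_eq (subvf _)).2.
  apply: contraNneq psi_neq0 => Hfull; apply/eqP/lform_eq0 => v.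
  apply: lform_core0; rewrite -base_form_hyperplane mem_base_vspace Hfull.
  exact: (@memvf _ V v).
rewrite -(leq_pmul2r n_gt0) -dim_base_vect mulSn -dim_base_vspace.
rewrite base_form_hyperplane -(limg_ker_dim (linfun (orbit_form psi)) fullv).
rewrite capfv addnC leq_add2r (leq_trans (dimvS (subvf _))) //.
by rewrite dimvf /dim /= mul1n.
Qed.

(** The forms vanishing on H make up an F-space of dimension n; the nonzero ones
    have H as their hyperplane, for dimension reasons. *)
Lemma card_form_hyperplane H : hyperplane H ->
  #|[set psi | (psi != 0) && (form_hyperplane psi == H)]|.+1 = (#|F| ^ n)%N.
Proof.
move=> /eqP dimH; pose B := base_vspace H; pose b := vbasis B.
have cE : (n = N - #|'I_(\dim B)|)%N.
  by rewrite card_ord dim_base_vspace dim_base_vect -dimH mulSn addnK.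
rewrite [in RHS]cE -(card_lform_eq0 (e := fun i : 'I_(\dim B) => b`_i)); last
  first.
  by move=> c c0; apply: (freeP (basis_free (vbasisP B)) c c0).
rewrite [in RHS](cardsD1 0) -add1n inE; congr (_ + _)%N.
  by apply/esym/eqP; rewrite eqb1; apply/forallP=> i; rewrite lform0l.
apply: eq_card => psi; rewrite !inE; have [//|psi_neq0] := eqVneq psi 0.
have /eqP dimHpsi := hyperplane_form psi_neq0.
apply/eqP/forallP=> [psiH i|psi0].
  apply/eqP/lform_core0; rewrite -base_form_hyperplane psiH.
  by apply/vbasis_mem/mem_nth; rewrite size_tuple.
have B0 v : v \in B -> lform psi v = 0.
  move/coord_vbasis->; rewrite linear_sum big1 // => i _.
  by rewrite linearZ /= (eqP (psi0 i)) scaler0.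
apply/esym/eqP; rewrite eqEdim -ltnS dimHpsi dimH leqnn andbT.
apply/subvP=> v Hv; rewrite -mem_base_vspace base_form_hyperplane.
by apply/form_coreP => a; apply: B0; rewrite mem_base_vspace; apply: memvZ.
Qed.

(** The dimension of A_psi. *)
Definition defect psi := (n - \rank (gram psi))%N.

Lemma defect0 : defect 0 = n.
Proof.
rewrite /defect (_ : gram 0 = 0) ?mxrank0 ?subn0 //.
by apply/matrixP=> i j; rewrite !mxE lform0l.
Qed.

Lemma weight_defect i psi : (i <= n)%N ->
  ((weight U (form_hyperplane psi))%:Z == k%:Z - n%:Z + i%:Z)
    = (defect psi == i).
Proof.
have := weight_form_hyperplane psi; have := rank_leq_row (gram psi).
rewrite /defect; lia.
Qed.

Lemma hyperplane_formP H : hyperplane H ->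
  exists2 psi, psi != 0 & form_hyperplane psi = H.
Proof.
move/card_form_hyperplane=> cardH.
pose A := [set psi | (psi != 0) && (form_hyperplane psi == H)].
have /card_gt0P[psi] : (0 < #|A|)%N.
  rewrite -ltnS cardH; apply: leq_trans (finNzRing_gt1 F) _.
  by rewrite -{1}[#|F|]expn1 leq_pexp2l ?adim_gt0 // ltnW ?finNzRing_gt1.
by rewrite inE => /andP[psi_neq0 /eqP <-]; exists psi.
Qed.

(** {vspace V} is not a finite type, so the hyperplanes are enumerated as the
    images of the forms of defect i, each obtained q^n - 1 times. *)
Lemma exactly_hyperplanes i : (i <= n)%N ->
  exists2 M, exactly M [pred H : {vspace V} | hyperplane H &&
      ((weight U H)%:Z == k%:Z - n%:Z + i%:Z)]
    & (M * (#|F| ^ n - 1))%N =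
      #|[set psi | (psi != 0) && (defect psi == i)]|.
Proof.
move=> i_le_n; pose A := [set psi | (psi != 0) && (defect psi == i)].
pose s := undup [seq form_hyperplane psi | psi in A].
have AP psi : psi \in A -> form_hyperplane psi \in s.
  by move=> Apsi; rewrite mem_undup map_f // mem_enum.
have sP : s =i [pred H | hyperplane H &&
    ((weight U H)%:Z == k%:Z - n%:Z + i%:Z)].
  move=> H; rewrite mem_undup !inE; apply/imageP/andP=> [[psi]|[hypH wH]].
    rewrite inE => /andP[psi_neq0 defpsi] ->.
    by rewrite weight_defect // hyperplane_form.
  have [psi psi_neq0 HE] := hyperplane_formP hypH.
  by exists psi => //; rewrite inE psi_neq0 -weight_defect // HE.
exists (size s); first by exists s; split; rewrite ?undup_uniq.
rewrite -sum1_card.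
transitivity (\sum_(psi in A) \sum_(H <- s) (form_hyperplane psi == H))%N; last
  first.
  apply: eq_bigr => psi /AP spsi.
  transitivity (\sum_(H <- s | H == form_hyperplane psi) 1)%N.
    rewrite [RHS]big_mkcond; apply: eq_bigr => H _.
    by rewrite eq_sym; case: eqP.
  by rewrite sum1_count count_uniq_mem ?undup_uniq // spsi.
rewrite exchange_big /= -sum1_size big_distrl /= big_seq [RHS]big_seq.
apply: eq_bigr => H; rewrite sP inE => /andP[hypH wH].
rewrite mul1n -(card_form_hyperplane hypH) subn1 /=.
rewrite (_ : [set _ | _] = [set psi in A | form_hyperplane psi == H]).
  rewrite -sum1dep_card big_mkcondr.
  by apply: eq_bigr => psi _; case: eqP.
apply/setP=> psi; rewrite !inE -andbA; congr (_ && _).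
case: (form_hyperplane psi =P H) wH => [<-|]; rewrite ?andbF //.
by rewrite weight_defect // => ->.
Qed.

End FormsAndHyperplanes.

(** * The distribution of weights *)

Section WeightDistribution.

Variables (F : finFieldType) (L : fieldExtType F) (V : vectType L).
Variables (U : {vspace base_vect V}) (h : nat).
Local Notation q := (#|F|%:R : rat).
Local Notation n := (\dim {:L}).
Local Notation k := (\dim U).
Local Notation r := (\dim {:V}).
Local Notation N := (\dim {: base_vect V}).
Implicit Types (psi : 'rV[F]_N) (H : {vspace V}).

Hypothesis scatU : scattered h U.
Hypothesis h_lt_r : (h < r)%N.
Hypothesis dimU : (h.+1 * k = r * n)%N.

Let q_gt1 : 1 < q. Proof. by rewrite ltr1n finNzRing_gt1. Qed.

Lemma dim_gt_scattered : (h < n)%N.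
Proof.
have k_ge := scattered_dim_ge scatU.
have k_gt0 : (0 < k)%N by apply: leq_trans k_ge; apply: leq_trans h_lt_r.
by rewrite -(leq_pmul2r k_gt0) dimU mulnC leq_mul2l k_ge orbT.
Qed.

Lemma dim_le_scattered : (n <= k)%N.
Proof. by rewrite -(@leq_pmul2l h.+1) // dimU leq_mul2r h_lt_r orbT. Qed.

(** Double counting of the pairs (psi, S) where the rows of S are s independent
    elements of A_psi: for fixed psi there are qfalling q (defect U psi) s, and
    for fixed S there are q^(r n - s k) forms, with r n = (h + 1) k. *)
Lemma defect_moment s : (s <= h.+1)%N ->
  \sum_psi qfalling q (defect U psi) s
    = qfalling q n s * (q ^+ k) ^+ (h.+1 - s).
Proof.
move=> sh; have -> : (q ^+ k) ^+ (h.+1 - s) = q ^+ (N - s * k).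
  by rewrite -exprM dim_base_vect -dimU -mulnBl mulnC.
pose P psi (S : 'M[F]_(s, n)) := row_free S && (S *m gram U psi == 0).
transitivity ((\sum_psi \sum_(S | P psi S) 1)%N%:R : rat).
  rewrite natr_sum; apply: eq_bigr => psi _; rewrite sum1dep_card.
  rewrite /defect -mxrank_ker -card_row_free_sub; congr _%:R.
  apply: eq_card => S.
  by rewrite !inE /P; congr (_ && _); apply/sub_kermxP/eqP.
have -> : qfalling q n s = #|[set S : 'M[F]_(s, n) | row_free S]|%:R.
  rewrite -[n in qfalling _ n _](mxrank1 F) -card_row_free_sub.
  by congr _%:R; apply: eq_card => S; rewrite !inE submx1 andbT.
rewrite -natrX -natrM -sum_nat_const (exchange_big_dep predT) //=.
rewrite (bigID (fun S : 'M[F]_(s, n) => row_free S)) /=.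
rewrite [X in (_ + X)%N]big1 ?addn0 => [|S /negPf S_nfree]; last first.
  by rewrite big_pred0 // => psi; rewrite /P S_nfree.
congr _%:R; apply: eq_big => [S | S freeS]; first by rewrite inE.
rewrite sum1dep_card -(card_mul_gram_eq0 scatU h_lt_r freeS sh).
by apply: eq_card => psi; rewrite !inE /P freeS.
Qed.

(** In the moment of order h + 1 the form 0 alone accounts for the total, and
    every other term, being nonnegative, vanishes. *)
Lemma defect_le psi : psi != 0 -> (defect U psi <= h)%N.
Proof.
move=> psi_neq0; have h_lt_n := dim_gt_scattered.
have := defect_moment (leqnn h.+1).
rewrite subnn expr0 mulr1 (bigD1 0) //= defect0.
move/(canRL (addKr _)); rewrite addNr => /eqP.
have qf_ge0 d : 0 <= qfalling q d h.+1.
  by have [/(qfalling_gt0 q_gt1)/ltW //|/qfalling_small->] := leqP h.+1 d.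
rewrite psumr_eq0 // => /allP/(_ psi (mem_index_enum _)) /implyP/(_ psi_neq0).
by apply: contraTT; rewrite -ltnNge => h_lt; apply: qfalling_neq0.
Qed.

Lemma gauss_moment s : (s <= h)%N ->
  \sum_(psi | psi != 0) gauss q (defect U psi) s
    = gauss q n s * ((q ^+ k) ^+ (h.+1 - s) - 1).
Proof.
move=> sh; rewrite /gauss -mulr_suml mulrAC; congr (_ / _).
have := defect_moment (leqW sh); rewrite (bigD1 0) //= defect0.
move/(canRL (addKr _)) => ->.
by rewrite mulrBr mulr1 addrC.
Qed.

Lemma card_defect i : (i <= h)%N ->
  #|[set psi | (psi != 0) && (defect U psi == i)]|%:R
    = gauss q n i * \sum_(j < (h - i).+1)
        (-1) ^+ j * gauss q (n - i) j * q ^+ 'C(j, 2) *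
        ((q ^+ k) ^+ (h - i - j + 1) - 1).
Proof.
move=> ih; rewrite -sum1dep_card natr_sum big_mkcondr /=.
transitivity (\sum_(psi | psi != 0) \sum_(j < (h - i).+1)
    (-1) ^+ j * q ^+ 'C(j, 2) * gauss q (i + j) i *
    gauss q (defect U psi) (i + j)).
  apply: eq_bigr => psi psi_neq0.
  by rewrite (gauss_orthogonality q_gt1 _ (defect_le psi_neq0)); case: eqP.
rewrite exchange_big mulr_sumr; apply: eq_bigr => j _ /=.
have jh : (j <= h - i)%N by rewrite -ltnS.
rewrite -mulr_sumr gauss_moment; last by lia.
have -> : (h.+1 - (i + j) = h - i - j + 1)%N by lia.
have nE : n = (i + (n - i))%N.
  by rewrite subnKC // (leq_trans ih) // ltnW // dim_gt_scattered.
have := gauss_trinomial q_gt1 i (n - i) j; rewrite -nE => trin.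
set Q := (_ ^+ _ - 1).
transitivity ((-1) ^+ j * q ^+ 'C(j, 2) * Q *
    (gauss q n (i + j) * gauss q (i + j) i)).
  by ring.
by rewrite trin; ring.
Qed.

End WeightDistribution.

Theorem theorem7p1 (q r n h : nat) (F : finFieldType) (L : fieldExtType F)
    (V : vectType L) (U : {vspace base_vect V}) :
  #|F| = q -> \dim {:L} = n -> \dim {:V} = r ->
  (0 < r)%N -> (0 < n)%N -> (0 < h)%N -> (h <= r - 1)%N ->
  scattered h U ->
  (h.+1 %| r * n)%N -> \dim U = (r * n %/ h.+1)%N ->
  forall i : nat, (i <= h)%N ->
    (exists N : nat,
       exactly N [pred H : {vspace V} | hyperplane H &&
         ((weight U H)%:Z == (r * n %/ h.+1)%N%:Z - n%:Z + i%:Z)]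
       /\ N%:R = hyperplane_count q r n h i)
    /\ 0 < hyperplane_count q r n h i.
Proof.
move=> qE nE rE r_gt0 n_gt0 _ hr scatU h_dvd dimU i ih.
have h_lt_r : (h < \dim {:V})%N by rewrite rE; lia.
have dimUE : (h.+1 * \dim U = \dim {:V} * \dim {:L})%N.
  by rewrite dimU mulnC divnK // nE rE.
have h_lt_n : (h < n)%N.
  by rewrite -nE; apply: dim_gt_scattered scatU h_lt_r dimUE.
have n_le_k : (n <= \dim U)%N.
  by rewrite -nE; apply: dim_le_scattered h_lt_r dimUE.
have q_ge2 : (2 <= q)%N by rewrite -qE finNzRing_gt1.
have q_gt1 : 1 < q%:R :> rat by rewrite ltr1n.
have qn_gt0 : 0 < q%:R ^+ n - 1 :> rat by rewrite subr_gt0 exprn_egt1 // -lt0n.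
have countE : hyperplane_count q r n h i = (q%:R ^+ n - 1)^-1 *
    (gauss q%:R n i * \sum_(j < (h - i).+1)
      (-1) ^+ j * gauss q%:R (n - i) j * q%:R ^+ 'C(j, 2) *
      ((q%:R ^+ \dim U) ^+ (h - i - j + 1) - 1)).
  rewrite /hyperplane_count big_mkord -mulrA !qbinomE //; congr (_ * (_ * _)).
  apply: eq_bigr => j _; rewrite subzn ?qbinomE //; last by lia.
  by rewrite -exprM dimU divn_mulAC.
have i_le_n : (i <= \dim {:L})%N by rewrite nE; lia.
have [M exM cardM] := exactly_hyperplanes U i_le_n.
split; last first.
  rewrite countE mulr_gt0 ?invr_gt0 // mulr_gt0 //.
    by rewrite gauss_gt0 //; lia.
  by apply: gauss_weight_sum_gt0; rewrite ?ler_nat //; lia.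
exists M; split; first by rewrite -dimU -nE.
rewrite countE; apply: (canRL (mulKf _)); first by rewrite gt_eqF.
rewrite -qE -nE -(card_defect scatU h_lt_r dimUE ih) -cardM natrM natrB.
  by rewrite natrX mulrC.
by rewrite expn_gt0 qE ltnW.
Qed.
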